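(* Consider the optimal aerocapture problem with augmented bank angle modulation (ABAM) described in the context, with state $x=(r,V,\gamma)$, controls $\sigma$ (bank angle) and $\alpha\in[\alpha_{\min},\alpha_{\max}]$ (angle of attack), and linear aerodynamic coefficients $C_D(\alpha)=C_{D,\alpha}\,\alpha+C_{D,0}$, $C_L(\alpha)=C_{L,\alpha}\,\alpha+C_{L,0}$. Let $\sigma^*,\alpha^*$ be the optimal control profiles, with corresponding trajectory $(r,V,\gamma)$ and costates $(\lambda_r,\lambda_v,\lambda_\gamma)$. Assume that the optimal bank angle profile is $\sigma^*=\sigma^*_{\mathrm{BAM}}$, i.e. $\sigma^*=\sigma_{\min}$ (lift-up flight, $u_1=\cos\sigma^*$ taken equal to $1$) when $H_\sigma=\lambda_\gamma>0$, and $\sigma^*=\sigma_{\max}$ (lift-down flight, $u_1=\cos\sigma^*$ taken equal to $-1$) when $H_\sigma=\lambda_\gamma<0$. Define $$H_{\alpha,\mathrm{up}}=-\lambda_v C_{D,\alpha}+\lambda_\gamma\frac{C_{L,\alpha}}{V},\qquad H_{\alpha,\mathrm{down}}=-\lambda_v C_{D,\alpha}-\lambda_\gamma\frac{C_{L,\alpha}}{V}.$$ Then: (i) during lift-up flight, $\alpha^*=\alpha_{\min}$ at times when $H_{\alpha,\mathrm{up}}>0$, and $\alpha^*=\alpha_{\max}$ at times when $H_{\alpha,\mathrm{up}}<0$; (ii) during lift-down flight, $\alpha^*=\alpha_{\min}$ at times when $H_{\alpha,\mathrm{down}}>0$, and $\alpha^*=\alpha_{\max}$ at times when $H_{\alpha,\mathrm{down}}<0$.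 (No claim is made that any particular switch of $\alpha^*$ or $\sigma^*$ actually occurs.)
   Context: **Dynamics.** The simplified longitudinal equations of motion of the vehicle in the atmosphere are $$\dot r=V\sin\gamma,\qquad \dot V=-D(\alpha)-\frac{\mu\sin\gamma}{r^2},\qquad \dot\gamma=\frac1V\left[L(\alpha)\,u_1+\left(V^2-\frac{\mu}{r}\right)\frac{\cos\gamma}{r}\right],$$ where $r>0$ is the radial distance, $V>0$ the velocity, $\gamma$ the flight path angle, $\mu>0$ the gravitational parameter, $u_1=\cos\sigma$, and the lift and drag accelerations are $$L(\alpha)=\frac{1}{2m}\rho V^2S_{ref}C_L(\alpha),\qquad D(\alpha)=\frac{1}{2m}\rho V^2S_{ref}C_D(\alpha),$$ with $\rho>0$ the atmospheric density (depending on the state through $r$), $S_{ref}>0$ the reference area and $m>0$ the mass. The aerodynamic coefficients are affine in $\alpha$: $C_D(\alpha)=C_{D,\alpha}\alpha+C_{D,0}$ and $C_L(\alpha)=C_{L,\alpha}\alpha+C_{L,0}$ with real constants $C_{D,\alpha},C_{D,0},C_{L,\alpha},C_{L,0}$. **Control constraints** (angles in degrees). $0\le\sigma_{\min}\le|\sigma|\le\sigma_{\max}\le180$ and $-30\le\alpha_{\min}\le\alpha\le\alpha_{\max}\le0$. **Lift-up and lift-down flight.** Lift-up flight means $\sigma=\sigma_{\min}$; lift-down flight means $\sigma=\sigma_{\max}$. Since $\sigma_{\min}$ is small and $\sigma_{\max}$ is large, $u_1$ is approximated by $u_1=1$ in lift-up flight and by $u_1=-1$ in lift-down flight. **Optimal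 aerocapture problem.** Given an initial condition, find control profiles that minimize $$\Delta V=\sqrt{2\mu}\left(\sqrt{\frac1{r_a}-\frac1{r_a+r_p^*}}-\sqrt{\frac1{r_a}-\frac1{2a}}\right)$$ subject to the dynamics, the control constraints, and the terminal constraint $r_a(r_{\rm exit},V_{\rm exit},\gamma_{\rm exit})-r_a^*=0$, where $$r_a=a\left(1+\sqrt{1-\frac{V_{\rm exit}^2r_{\rm exit}^2\cos^2\gamma_{\rm exit}}{\mu a}}\right),\qquad a=\frac{\mu}{2\mu/r_{\rm exit}-V_{\rm exit}^2}.$$ Here $r_{\rm exit},V_{\rm exit},\gamma_{\rm exit}$ are the radius, velocity and flight path angle at atmospheric exit, and $r_a^*,r_p^*$ are the given target apoapsis and periapsis radii. There is no running cost; the cost depends only on the terminal state. **Hamiltonian and optimality.** With costates $\lambda=(\lambda_r,\lambda_v,\lambda_\gamma)$ adjoined to $(\dot r,\dot V,\dot\gamma)$, the Hamiltonian is $$H(x,u,\lambda)=\lambda_rV\sin\gamma+\lambda_v\left(-D(\alpha)-\frac{\mu\sin\gamma}{r^2}\right)+\frac{\lambda_\gamma}{V}\left[L(\alpha)u_1+\left(V^2-\frac{\mu}{r}\right)\frac{\cos\gamma}{r}\right],\qquad u=(u_1,\alpha).$$ The costates are those given by Pontryagin's Minimum Principle for the optimal solution, so that $\dot\lambda=-\partial H/\partial x$ along it. Optimal controls are understood in the sense of this principle: the optimal control profile satisfies the optimality condition $u^*\in\arg\min_{u\in\mathcal U}H(x,u,\lambda)$ at each time, where $\mathcal U$ is the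 admissible set of controls. In the present setting the bank angle profile (hence $u_1^*$) is prescribed by the assumption $\sigma^*=\sigma^*_{\mathrm{BAM}}$, and the condition determines $\alpha^*$: at each time $t$, $\alpha^*(t)$ minimizes $\alpha\mapsto H(x(t),(u_1^*(t),\alpha),\lambda(t))$ over $[\alpha_{\min},\alpha_{\max}]$. **The profile $\sigma^*_{\mathrm{BAM}}$.** It is the bang-bang bank angle profile equal to $\sigma_{\min}$ (lift-up) if $H_\sigma=\lambda_\gamma>0$ and equal to $\sigma_{\max}$ (lift-down) if $H_\sigma=\lambda_\gamma<0$, where $H_\sigma$ is called the switching curve associated with $\sigma$. The functions $H_{\alpha,\mathrm{up}}$ and $H_{\alpha,\mathrm{down}}$ are the switching curves associated with $\alpha$ in lift-up and lift-down flight. *)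

(* Defs.v *)
From mathcomp Require Import all_boot all_order all_algebra.
From mathcomp Require Import all_classical all_reals all_analysis.

Set Implicit Arguments.
Unset Strict Implicit.
Unset Printing Implicit Defensive.

Import Order.TTheory GRing.Theory Num.Theory.
Import numFieldNormedType.Exports.

Local Open Scope classical_set_scope.
Local Open Scope ring_scope.

(* [sigma] and [alpha] are in degrees, the flight path angle is in radians.
   Where exactly the vehicle leaves the atmosphere is kept abstract: [at_exit]
   is the set of states (r, V, gamma) regarded as atmospheric exit. *)
Record aerocapture (R : realType) := Aerocapture {
  mu : R;
  mass : R;
  Sref : R;
  rho : R -> R;
  CDa : R;
  CD0 : R;
  CLa : R;
  CL0 : R;
  sigma_min : R;
  sigma_max : R;
  alpha_min : R;
  alpha_max : R;
  r_init : R;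
  V_init : R;
  gam_init : R;
  at_exit : R -> R -> R -> Prop;
  ra_target : R;
  rp_target : R;
  mu_gt0 : 0 < mu;
  mass_gt0 : 0 < mass;
  Sref_gt0 : 0 < Sref;
  rho_gt0 : forall r, 0 < r -> 0 < rho r;
  sigma_min_ge0 : 0 <= sigma_min;
  sigma_min_max : sigma_min <= sigma_max;
  sigma_max_le : sigma_max <= 180;
  alpha_min_ge : - 30 <= alpha_min;
  alpha_min_max : alpha_min <= alpha_max;
  alpha_max_le0 : alpha_max <= 0;
  ra_target_gt0 : 0 < ra_target;
  rp_target_gt0 : 0 < rp_target
}.

(* Only the values on [0, tf] matter. The profile [u1] is kept next to [sigma]
   because it is cos sigma only up to the approximation in [bank_input]. *)
Record process (R : realType) := Process {
  tf : R;
  r_ : R -> R;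
  V_ : R -> R;
  gam_ : R -> R;
  sigma_ : R -> R;
  u1_ : R -> R;
  alpha_ : R -> R
}.

Record costates (R : realType) := Costates {
  lam_r : R -> R;
  lam_v : R -> R;
  lam_g : R -> R
}.

Section Aerocapture.
Variables (R : realType) (P : aerocapture R).
Implicit Types (r V g u a s t : R) (z : process R) (l : costates R).

Definition CD a := CDa P * a + CD0 P.
Definition CL a := CLa P * a + CL0 P.

Definition lift r V a :=
  1 / (2 * mass P) * rho P r * V ^+ 2 * Sref P * CL a.
Definition drag r V a :=
  1 / (2 * mass P) * rho P r * V ^+ 2 * Sref P * CD a.

Definition rdot (r V g : R) := V * sin g.
Definition Vdot r V g a := - drag r V a - mu P * sin g / r ^+ 2.
Definition gdot r V g u a :=
  1 / V * (lift r V a * u + (V ^+ 2 - mu P / r) * (cos g / r)).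

Definition hamiltonian r V g u a (lr lv lg : R) :=
  lr * (V * sin g)
  + lv * (- drag r V a - mu P * sin g / r ^+ 2)
  + lg / V * (lift r V a * u + (V ^+ 2 - mu P / r) * (cos g / r)).

(* x' = f on [0, T] in the sense of Caratheodory: x is the indefinite Lebesgue
   integral of the integrable function f. A derivative at every time would rule
   out switches of the controls. *)
Definition solves_ode (T : R) (x f : R -> R) :=
  lebesgue_measure.-integrable `[0, T] (EFin \o f) /\
  forall t, 0 <= t <= T ->
    x t = x 0 + \int[lebesgue_measure]_(s in `[0, t]) f s.

(* u1 = cos sigma, except that it is taken to be 1 in lift-up flight and -1 in
   lift-down flight; a relation, so that sigma_min = sigma_max is unproblematic. *)
Definition bank_input s u :=
  [\/ `|s| = sigma_min P /\ u = 1,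
      `|s| = sigma_max P /\ u = - 1
    | [/\ `|s| <> sigma_min P, `|s| <> sigma_max P
        & u = cos (s * pi / 180)]].

Definition lift_up z t := sigma_ z t = sigma_min P /\ u1_ z t = 1.
Definition lift_down z t := sigma_ z t = sigma_max P /\ u1_ z t = - 1.

Definition semi_major r V := mu P / (2 * mu P / r - V ^+ 2).

Definition apoapsis r V g :=
  let a := semi_major r V in
  a * (1 + Num.sqrt (1 - V ^+ 2 * r ^+ 2 * cos g ^+ 2 / (mu P * a))).

Definition deltaV r V g :=
  let a := semi_major r V in
  let ra := apoapsis r V g in
  Num.sqrt (2 * mu P) *
    (Num.sqrt (1 / ra - 1 / (ra + rp_target P))
     - Num.sqrt (1 / ra - 1 / (2 * a))).

Definition cost z := deltaV (r_ z (tf z)) (V_ z (tf z)) (gam_ z (tf z)).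

Record feasible z : Prop := Feasible {
  feas_tf : 0 < tf z;
  feas_init : [/\ r_ z 0 = r_init P, V_ z 0 = V_init P
                & gam_ z 0 = gam_init P];
  feas_pos : forall t, 0 <= t <= tf z -> 0 < r_ z t /\ 0 < V_ z t;
  feas_meas : [/\ measurable_fun `[0, tf z] (sigma_ z),
                  measurable_fun `[0, tf z] (u1_ z)
                & measurable_fun `[0, tf z] (alpha_ z)];
  feas_sigma : forall t, 0 <= t <= tf z ->
    sigma_min P <= `|sigma_ z t| <= sigma_max P;
  feas_u1 : forall t, 0 <= t <= tf z -> bank_input (sigma_ z t) (u1_ z t);
  feas_alpha : forall t, 0 <= t <= tf z ->
    alpha_min P <= alpha_ z t <= alpha_max P;
  feas_r : solves_ode (tf z) (r_ z)
    (fun t => rdot (r_ z t) (V_ z t) (gam_ z t));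
  feas_V : solves_ode (tf z) (V_ z)
    (fun t => Vdot (r_ z t) (V_ z t) (gam_ z t) (alpha_ z t));
  feas_gam : solves_ode (tf z) (gam_ z)
    (fun t => gdot (r_ z t) (V_ z t) (gam_ z t) (u1_ z t) (alpha_ z t));
  feas_exit : at_exit P (r_ z (tf z)) (V_ z (tf z)) (gam_ z (tf z));
  feas_ra : apoapsis (r_ z (tf z)) (V_ z (tf z)) (gam_ z (tf z))
            - ra_target P = 0
}.

Definition optimal z :=
  feasible z /\ forall z', feasible z' -> cost z <= cost z'.

Definition H_along z l t r V g :=
  hamiltonian r V g (u1_ z t) (alpha_ z t) (lam_r l t) (lam_v l t) (lam_g l t).

(* [pmp_rho] makes dH/dr exist along the trajectory; otherwise [derive1] would
   return a meaningless value in [pmp_lam_r]. The minimum condition is over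
   alpha only, with u1 fixed at its prescribed value. *)
Record pmp z l : Prop := Pmp {
  pmp_rho : forall t, 0 <= t <= tf z -> derivable (rho P) (r_ z t) 1;
  pmp_lam_r : solves_ode (tf z) (lam_r l)
    (fun t => - derive1 (fun r => H_along z l t r (V_ z t) (gam_ z t)) (r_ z t));
  pmp_lam_v : solves_ode (tf z) (lam_v l)
    (fun t => - derive1 (fun V => H_along z l t (r_ z t) V (gam_ z t)) (V_ z t));
  pmp_lam_g : solves_ode (tf z) (lam_g l)
    (fun t => - derive1 (fun g => H_along z l t (r_ z t) (V_ z t) g) (gam_ z t));
  pmp_min : forall t, 0 <= t <= tf z ->
    forall a, alpha_min P <= a <= alpha_max P ->
      hamiltonian (r_ z t) (V_ z t) (gam_ z t) (u1_ z t) (alpha_ z t)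
        (lam_r l t) (lam_v l t) (lam_g l t)
      <= hamiltonian (r_ z t) (V_ z t) (gam_ z t) (u1_ z t) a
           (lam_r l t) (lam_v l t) (lam_g l t)
}.

(* The switching curve of sigma is lam_g. *)
Definition bam z l := forall t, 0 <= t <= tf z ->
  (0 < lam_g l t -> lift_up z t) /\ (lam_g l t < 0 -> lift_down z t).

Definition H_alpha_up z l t :=
  - lam_v l t * CDa P + lam_g l t * (CLa P / V_ z t).
Definition H_alpha_down z l t :=
  - lam_v l t * CDa P - lam_g l t * (CLa P / V_ z t).

End Aerocapture.

(* Main.v *)
Require Import Defs.
From mathcomp Require Import all_boot all_order all_algebra.
From mathcomp Require Import all_classical all_reals all_analysis.
From mathcomp Require Import ring.
Import Order.TTheory GRing.Theory Num.Theory.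
Local Open Scope ring_scope.

(** Lift and drag are affine in the angle of attack, and the Hamiltonian is
    affine in both, so for a fixed state, costate and bank input it is affine in
    [alpha]. Its slope is the product of [rho V^2 Sref / (2 m)], which is
    positive along a feasible trajectory, and of
    [- lam_v CDa + u1 lam_g CLa / V] ([hamiltonian_alphaB]). The second factor
    is the switching curve: [H_alpha_up] for [u1 = 1], [H_alpha_down] for
    [u1 = -1]. The minimum principle makes the optimal [alpha] a minimizer of
    this affine function on [[alpha_min, alpha_max]], and a minimizer of an
    affine function of nonzero slope is the endpoint selected by the sign of the
    slope ([argmin_affine_bang_bang]). *)

Lemma argmin_affine_bang_bang {R : realDomainType} {f : R -> R} {k lo hi x : R} :
  (forall a b, f a - f b = k * (a - b)) ->
  lo <= x <= hi -> (forall a, lo <= a <= hi -> f x <= f a) ->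
  (0 < k -> x = lo) /\ (k < 0 -> x = hi).
Proof.
move=> fB /andP[lox xhi] fmin; have lohi := le_trans lox xhi.
split=> k_sign; apply/eqP; rewrite eq_le ?lox ?xhi ?andbT //=.
- rewrite -subr_le0 -(pmulr_rle0 _ k_sign) -fB subr_le0.
  by apply: fmin; rewrite lexx.
- rewrite -subr_le0 -(nmulr_rge0 _ k_sign) -fB subr_ge0.
  by apply: fmin; rewrite lexx lohi.
Qed.

Section SwitchingStructure.
Context {R : realType} {P : aerocapture R}.

(** Dynamic pressure times reference area per unit mass, the factor that turns
    the coefficients [CL] and [CD] into accelerations. *)
Definition aero_scale (r V : R) :=
  1 / (2 * mass P) * rho P r * V ^+ 2 * Sref P.

Lemma aero_scale_gt0 {r V : R} : 0 < r -> 0 < V -> 0 < aero_scale r V.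
Proof.
move=> r_gt0 V_gt0; rewrite /aero_scale !mulr_gt0 ?exprn_gt0 ?Sref_gt0 //.
  by rewrite invr_gt0 mulr_gt0 // mass_gt0.
exact: rho_gt0.
Qed.

Lemma hamiltonian_alphaB (r V g u lr lv lg a b : R) :
  hamiltonian P r V g u a lr lv lg - hamiltonian P r V g u b lr lv lg =
  aero_scale r V * (- lv * CDa P + lg * u * (CLa P / V)) * (a - b).
Proof.
rewrite /hamiltonian /Defs.lift /drag -!/(aero_scale r V) /CD /CL.
ring.
Qed.

(** The minimum condition alone, for an arbitrary prescribed bank input:
    lift-up and lift-down flight are the instances [u1 = 1] and [u1 = -1]. *)
Lemma pmp_alpha_bang_bang {z : process R} {l : costates R} {t : R} :
  feasible P z -> pmp P z l -> 0 <= t <= tf z ->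
  let k : R := - lam_v l t * CDa P + lam_g l t * u1_ z t * (CLa P / V_ z t) in
  (0 < k -> alpha_ z t = alpha_min P) /\ (k < 0 -> alpha_ z t = alpha_max P).
Proof.
move=> zfeas zpmp tz k; have [r_gt0 V_gt0] := feas_pos zfeas tz.
have scale_gt0 := aero_scale_gt0 r_gt0 V_gt0.
rewrite -(pmulr_rgt0 k scale_gt0) -(pmulr_rlt0 k scale_gt0).
apply: (argmin_affine_bang_bang _ (feas_alpha zfeas tz)
                                  (pmp_min zpmp tz)) => a b.
exact: hamiltonian_alphaB.
Qed.

End SwitchingStructure.

Theorem theorem1 (R : realType) (P : aerocapture R) (z : process R)
    (l : costates R)
    (hopt : optimal P z) (hpmp : pmp P z l) (hbam : bam P z l) :
  (forall t : R, 0 <= t <= tf z -> lift_up P z t ->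
     (0 < H_alpha_up P z l t -> alpha_ z t = alpha_min P) /\
     (H_alpha_up P z l t < 0 -> alpha_ z t = alpha_max P)) /\
  (forall t : R, 0 <= t <= tf z -> lift_down P z t ->
     (0 < H_alpha_down P z l t -> alpha_ z t = alpha_min P) /\
     (H_alpha_down P z l t < 0 -> alpha_ z t = alpha_max P)).
Proof.
have [zfeas _] := hopt.
split=> t tz [_ u1E]; have := pmp_alpha_bang_bang zfeas hpmp tz; rewrite u1E.
- by rewrite mulr1.
- by rewrite mulrN1 (mulNr (lam_g l t)).
Qed.
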